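(* Let $\mathcal U$ be a topological space, let $R:\mathcal U\to\mathcal U$ be a map, let $k(z,w)$ be a positive definite function on $\mathcal U$, and let $(e_j)_{j\in J}$ be an orthonormal basis of $\mathcal H(k)$. Let $K(z,w)$ be a positive definite function on $\mathcal U$ such that $$K(z,w)=k(z,w)\,K(R(z),R(w)),\quad\forall z,w\in\mathcal U,$$ and let $\mathcal H(K)$ be the reproducing kernel Hilbert space of functions on $\mathcal U$ with reproducing kernel $K$. Then the operators $$(S_jf)(z)=e_j(z)f(R(z)),\quad j\in J,$$ are continuous from $\mathcal H(K)$ into itself and satisfy $$\sum_{j\in J}S_jS_j^*=I_{\mathcal H(K)}.$$
   Context: For a complex number $c$, $c^*$ denotes its complex conjugate. A function $k:\mathcal U\times\mathcal U\to\mathbb C$ is positive definite on $\mathcal U$ if $\sum_{p,q=1}^M c_p^*\,k(w_p,w_q)\,c_q\ge 0$ for all $M\in\mathbb N$, $w_1,\dots,w_M\in\mathcal U$, $c_1,\dots,c_M\in\mathbb C$. $\mathcal H(k)$ denotes the associated reproducing kernel Hilbert space of functions on $\mathcal U$; for any orthonormal basis $(e_j)_{j\in J}$ of it (the index set $J$ need not be countable), $k(z,w)=\sum_{j\in J}e_j(z)e_j(w)^*$. If $J$ is infinite, the sum of operators is understood in the strong operator topology. *)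

(* Defs.v *)
From HB Require Import structures.
From mathcomp Require Import all_boot all_order all_algebra finmap.
From mathcomp Require Import sesquilinear complex.
From mathcomp Require Import all_classical all_reals all_analysis.
From mathcomp Require Import summability.

Set Implicit Arguments.
Unset Strict Implicit.
Unset Printing Implicit Defensive.

Import Order.TTheory GRing.Theory Num.Theory.
Import numFieldNormedType.Exports.

Local Open Scope classical_set_scope.
Local Open Scope ring_scope.

(* In R[i], 0 <= z means that z is real and nonnegative. *)
Definition positive_definite (R : realType) (U : Type) (k : U -> U -> R[i]) :=
  forall (M : nat) (w : 'I_M -> U) (c : 'I_M -> R[i]),
    0 <= \sum_(p < M) \sum_(q < M) (c p)^* * k (w p) (w q) * c q.

(* A Hilbert space of functions on U with reproducing kernel k, which is unique
   up to an isometry preserving [ev]. Its elements are identified with functions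
   on U through the injective linear map [ev]; [kfun w] is the function k(., w).
   The inner product is linear in its first argument and antilinear in the
   second one, so that f(w) = <f, k(., w)>. *)
Record rkhs (R : realType) (U : Type) (k : U -> U -> R[i]) := RKHS {
  rkhs_car :> completeNormedModType R[i];
  dot : {dot rkhs_car for Num.conj};
  dot_norm : forall f, dot f f = `|f| ^+ 2;
  ev : {linear rkhs_car -> (U -> R[i])};
  ev_inj : injective ev;
  kfun : U -> rkhs_car;
  kfunE : forall z w, ev (kfun w) z = k z w;
  reproducing : forall f w, dot f (kfun w) = ev f w }.

Section hilbert_space_notions.
Variables (R : realType) (U : Type) (k : U -> U -> R[i]) (H : rkhs k).

Definition finite_span (J : choiceType) (e : J -> H) : set H :=
  [set f | exists (A : {fset J}) (c : J -> R[i]),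
     f = partial_sum (fun j => c j *: e j) A].

Definition orthonormal_basis (J : choiceType) (e : J -> H) :=
  (forall i j, dot H (e i) (e j) = (i == j)%:R) /\
  closure (finite_span e) = [set: H].

Definition is_adjoint (S T : H -> H) :=
  forall f g, dot H (S f) g = dot H f (T g).

(* Convergence, in the strong operator topology, of the net of the partial sums
   indexed by the finite subsets of J ordered by inclusion. *)
Definition strong_sum (J : choiceType) (T : J -> H -> H) (L : H -> H) :=
  forall f, partial_sum (fun j => T j f) @ totally --> L f.

End hilbert_space_notions.

(* Main.v *)
Require Import Defs.
From HB Require Import structures.
From mathcomp Require Import all_boot all_order all_algebra finmap.
From mathcomp Require Import sesquilinear complex.
From mathcomp Require Import all_classical all_reals all_analysis.
From mathcomp Require Import summability.
From mathcomp Require Import ring lra.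

Set Implicit Arguments.
Unset Strict Implicit.
Unset Printing Implicit Defensive.

Import Order.TTheory GRing.Theory Num.Theory.
Import numFieldNormedType.Exports.

Local Open Scope classical_set_scope.
Local Open Scope ring_scope.

(** The adjoint of [S_j] should send the kernel function [K_w] to
[e_j(w)^* K_(rho w)].  On a finite combination [f = sum_p c_p K_(w_p)] this rule
gives [T_j f = sum_p c_p e_j(w_p)^* K_(rho w_p)], so that
[sum_(j in A) |T_j f|^2] is equal to
[sum_(p,q) c_p c_q^* K(rho w_q, rho w_p) sum_(j in A) e_j(w_q) e_j(w_p)^*].
As [A] grows, the inner sum tends to [k(w_q, w_p)] ([kernel_expansion]), and by
the functional equation the whole expression tends to
[sum_(p,q) c_p c_q^* K(w_q, w_p) = |f|^2] ([pull_norm_cvg]).  This one limit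
carries everything.

- Its terms are nonnegative, hence every partial sum is at most [|f|^2]; in
  particular [|T_j f| <= |f|] on combinations of kernel functions.
- For [f] in [H(K)], the functional sending a combination [g] to
  [<T_j g, f>] is therefore bounded by [|f| |g|], and the vector representing it
  is the function [e_j (f o rho)], which thus lies in [H(K)] and has norm at
  most [|f|] ([mult_comp_exists]).  So [S_j] is a contraction of [H(K)], and its
  adjoint is the continuous extension of [T_j].
- Let [P_A = sum_(j in A) S_j T_j].  From [sum_(j in A) |T_j f|^2 <= |f|^2] for
  all [f], the defect satisfies
  [|f - P_A f|^2 <= |f|^2 - sum_(j in A) |T_j f|^2] ([defect_le]).  The right
  side tends to 0 for combinations of kernel functions, which are dense
  ([comb_dense]), and [1 - P_A] is a contraction, so [P_A] tends strongly to the
  identity ([strong_cvg_dense]).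

Membership in [H(K)], density of the kernel functions and existence of adjoints
all come from one form of the Riesz representation theorem
([riesz_relation]), for a bounded functional given by its graph over a subspace
that need be neither closed nor dense. *)

#[local] Existing Instance totally_filter.

(** * Inequalities preserved by limits *)

(** On complex numbers the order is partial, so the complement of this set is
larger than the set where [g x < f x]; but [a <= b] holds exactly when
[|b - a| = b - a], and this is an equation between continuous functions. *)
Lemma closed_le_continuous (K : numFieldType) (T : topologicalType)
    (f g : T -> K) :
  continuous f -> continuous g -> closed [set x | f x <= g x].
Proof.
move=> cf cg.
pose h x := `|g x - f x| - (g x - f x).
have ch : continuous h.
  move=> x; apply: cvgB; last by apply: cvgB; [exact: cg | exact: cf].
  by apply: cvg_norm; apply: cvgB; [exact: cg | exact: cf].
have -> : [set x | f x <= g x] = h @^-1` [set 0].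
  apply/seteqP; split => x /=; rewrite /h -subr_ge0.
    by move=> /ger0_norm ->; rewrite subrr.
  by move=> /eqP; rewrite subr_eq0 => /eqP <-.
apply: preimage_closed => //.
exact/accessible_closed_set1/hausdorff_accessible/norm_hausdorff.
Qed.

Lemma dense_le (K : numFieldType) (T : topologicalType) (D : set T)
    (f g : T -> K) :
  closure D = [set: T] -> continuous f -> continuous g ->
  (forall x, D x -> f x <= g x) -> forall x, f x <= g x.
Proof.
move=> dD cf cg fg x; have /closure_id E := closed_le_continuous cf cg.
have : closure D x by rewrite dD.
by move/(closureS fg); rewrite -E.
Qed.

Lemma partial_sum_le_cvg (C : numFieldType) (J : choiceType) (x : J -> C)
    (l : C) :
  (forall j, 0 <= x j) -> partial_sum x A @[A --> totally] --> l ->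
  forall A, partial_sum x A <= l.
Proof.
move=> x0 xl A.
have cl : closed [set y : C | partial_sum x A <= y].
  apply: (@closed_le_continuous _ _ (fun=> partial_sum x A) id).
    exact: cst_continuous.
  by move=> y; exact: cvg_id.
apply: (closed_cvg _ cl) xl; exists A => // B /= AB.
rewrite /partial_sum -!(big_seq_fsetE _ _ predT x) /=.
rewrite (eq_big_seq (fun i => if i \in A then x i else 0)); last by move=> i ->.
rewrite (big_fset_incl _ AB); last by move=> i iB /negPf ->.
by apply: ler_sum => i _; case: ifP.
Qed.

Lemma contraction_continuous (C : numFieldType) (V W : normedModType C)
    (f : {linear V -> W}) :
  (forall x, `|f x| <= `|x|) -> continuous f.
Proof.
move=> f_le x; apply/cvgrPdist_lt => d d0; near=> y.
by rewrite -linearB (le_lt_trans (f_le _)).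
Unshelve. all: by end_near. Qed.

(** * Inner products *)

Section pre_hilbert.
Variables (C : numClosedFieldType) (H : normedModType C).
Variable dot : {dot H for Num.conj}.
Hypothesis dot_norm : forall f, dot f f = `|f| ^+ 2.

Lemma dotC u v : dot u v = (dot v u)^*.
Proof. by rewrite hermC /= mul1r. Qed.

Lemma dotDl u v w : dot (u + v) w = dot u w + dot v w.
Proof. exact: linearDl. Qed.

Lemma dotBl u v w : dot (u - v) w = dot u w - dot v w.
Proof. exact: linearBl. Qed.

Lemma dotDr u v w : dot w (u + v) = dot w u + dot w v.
Proof. exact: linearDr. Qed.

Lemma dotBr u v w : dot w (u - v) = dot w u - dot w v.
Proof. exact: linearBr. Qed.

Lemma dotZl t u v : dot (t *: u) v = t * dot u v.
Proof. exact: linearZl_LR. Qed.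

Lemma dotZr t u v : dot u (t *: v) = t^* * dot u v.
Proof. exact: linearZr_LR. Qed.

Lemma dot_suml I (r : seq I) (P : pred I) (E : I -> H) v :
  dot (\sum_(i <- r | P i) E i) v = \sum_(i <- r | P i) dot (E i) v.
Proof. exact: linear_sumlz. Qed.

Lemma dot_sumr I (r : seq I) (P : pred I) (E : I -> H) v :
  dot v (\sum_(i <- r | P i) E i) = \sum_(i <- r | P i) dot v (E i).
Proof. exact: linear_sumr. Qed.

Lemma normD_sqr u v :
  `|u + v| ^+ 2 = `|u| ^+ 2 + `|v| ^+ 2 + (dot u v + dot v u).
Proof. by rewrite -!dot_norm dnormD -dotC. Qed.

Lemma normB_sqr u v :
  `|u - v| ^+ 2 = `|u| ^+ 2 + `|v| ^+ 2 - (dot u v + dot v u).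
Proof. by rewrite -!dot_norm dnormB -dotC. Qed.

Lemma cauchy_schwarz u v : `|dot u v| <= `|u| * `|v|.
Proof.
have [->|v0] := eqVneq v 0; first by rewrite linear0r !normr0 mulr0.
have v2 : 0 < `|v| ^+ 2 by rewrite exprn_gt0 // normr_gt0.
rewrite -(@ler_pXn2r _ 2) ?nnegrE ?mulr_ge0 //.
have : 0 <= `| `|v| ^+ 2 *: u - dot u v *: v| ^+ 2 by rewrite exprn_ge0.
rewrite normB_sqr !dotZl !dotZr !normrZ !exprMn ger0_norm ?exprn_ge0 //.
rewrite rmorphXn /= (geC0_conj (normr_ge0 v)) (dotC v u).
rewrite (_ : _ - _ =
    `|v| ^+ 2 * (`|u| ^+ 2 * `|v| ^+ 2 - `|dot u v| ^+ 2)); last first.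
  by rewrite normCK; ring.
by rewrite pmulr_rge0 // subr_ge0.
Qed.

Lemma dotl_continuous v : continuous (fun u => dot u v).
Proof.
move=> u; apply/cvgrPdist_lt => d d0.
have v0 : 0 < `|v| + 1 by rewrite ltr_wpDl.
near=> w.
rewrite -dotBl (le_lt_trans (cauchy_schwarz _ _)) //.
rewrite (@le_lt_trans _ _ (`|u - w| * (`|v| + 1))) ?ler_wpM2l ?lerDl //.
rewrite -ltr_pdivlMr //.
near: w; apply: cvgr_dist_lt; [exact: cvg_id | exact: divr_gt0].
Unshelve. all: by end_near. Qed.

End pre_hilbert.

(** * The Riesz representation theorem *)

Section riesz.
Variables (R : realType) (H : completeNormedModType R[i]).
Variable dot : {dot H for Num.conj}.
Hypothesis dot_norm : forall f, dot f f = `|f| ^+ 2.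

Lemma ReD (x y : R[i]) : complex.Re (x + y) = complex.Re x + complex.Re y.
Proof. by case: x; case: y. Qed.

Lemma ge0_Re (x : R[i]) : 0 <= x -> x = (complex.Re x)%:C%C.
Proof. by case: x => a b; rewrite lecE /= => /andP[/eqP -> _]. Qed.

Lemma ReN (x : R[i]) : complex.Re (- x) = - complex.Re x.
Proof. by case: x. Qed.

Lemma ReM_real (r : R) (x : R[i]) : complex.Re (r%:C%C * x) = r * complex.Re x.
Proof. by case: x => a b; rewrite /= mul0r subr0. Qed.

Lemma Re_half (x : R[i]) : complex.Re (2^-1 * x) = 2^-1 * complex.Re x.
Proof. by rewrite -ReM_real fmorphV rmorph_nat. Qed.

Lemma Re_conj (x : R[i]) : complex.Re x^* = complex.Re x.
Proof. by case: x. Qed.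

Lemma Re_norm_ge0 (V : normedZmodType R[i]) (u : V) : 0 <= complex.Re `|u|.
Proof. by have := normr_ge0 u; rewrite lecE => /andP[]. Qed.

(** For [a = phi u] with [phi] linear, minimizing [|u|^2 - 2 Re (phi u)] over
[u] is projecting the vector that represents [phi]: if [phi u = <u, h>], this
quantity is [|u - h|^2 - |h|^2]. *)
Definition energy (u : H) (a : R[i]) : R :=
  complex.Re (`|u| ^+ 2) - complex.Re a *+ 2.

Lemma ger0_ReX (V : normedZmodType R[i]) (u : V) :
  complex.Re (`|u| ^+ 2) = complex.Re `|u| ^+ 2 :> R.
Proof. by rewrite {1}(ge0_Re (normr_ge0 u)) -rmorphXn. Qed.

(** [G u a] is the graph of a functional.  A relation is used because the
functionals of interest are given on expressions of [u] as a finite combination;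
that the value depends on [u] alone follows from [G_bounded]. *)
Variable G : H -> R[i] -> Prop.
Hypothesis G_linear : forall t u a v b,
  G u a -> G v b -> G (t *: u + v) (t * a + b).
Hypothesis G0 : G 0 0.
Variable c : R[i].
Hypothesis c_ge0 : 0 <= c.
Hypothesis G_bounded : forall u a, G u a -> `|a| <= c * `|u|.

Lemma energy_ge u a : G u a -> - complex.Re c ^+ 2 <= energy u a.
Proof.
move=> /G_bounded; rewrite /energy ger0_ReX (ge0_Re (normr_ge0 u)) /=.
set n := complex.Re `|u|.
case: a => a1 a2; case: c => c1 c2; rewrite normc_def lecE /= => /andP[_].
rewrite !mulr0 subr0.
have : a1 <= Num.sqrt (a1 ^+ 2 + a2 ^+ 2).
  rewrite (le_trans (ler_norm _)) // -sqrtr_sqr ler_wsqrtr // lerDl sqr_ge0 //.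
have := sqr_ge0 (n - c1); rewrite sqrrB => ? ? ?; lra.
Qed.

(** The parallelogram identity: it makes every minimizing sequence Cauchy. *)
Lemma energy_midpoint u a v b :
  complex.Re `|u - v| ^+ 2 =
  energy u a *+ 2 + energy v b *+ 2
  - energy (2^-1 *: (u + v)) (2^-1 * (a + b)) *+ 4.
Proof.
have := normB_sqr dot_norm u v; have := normD_sqr dot_norm u v.
rewrite /energy normrZ exprMn -!ger0_ReX => -> ->.
rewrite ger0_norm ?invr_ge0 // expr2 -mulrA !Re_half !ReD ReN !ReD.
lra.
Qed.

(** The first variation at [u] in the direction [v]: at a minimizer the linear
term vanishes, which says that [b = <v, u>]. *)
Lemma energy_var u a t v b :
  energy (u + t *: v) (a + t * b) =
  energy u a + complex.Re (`|t| ^+ 2) * complex.Re `|v| ^+ 2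
  - complex.Re (t * (b - dot v u)) *+ 2.
Proof.
have := normD_sqr dot_norm u (t *: v).
rewrite dotZl dotZr (dotC dot u v) -rmorphM normrZ exprMn.
rewrite /energy -!ger0_ReX => ->.
rewrite mulrBr {1}(ge0_Re (exprn_ge0 2 (normr_ge0 t))).
rewrite !ReD ReM_real Re_conj ReN.
ring.
Qed.

(** The sets [B d] of [d]-almost minimizers of the energy form the basis of a
Cauchy filter by the parallelogram identity, and its limit [h] represents the
functional by the first variation.  Being a limit of vectors of the domain, [h]
lies in its closure, and there [|<u, h>| <= c |u|], which for [u = h] bounds
the norm. *)
Lemma riesz_relation : exists h : H,
  [/\ forall u a, G u a -> a = dot u h,
      closure [set u | exists a, G u a] h
    & `|h| <= c].
Proof.
pose E := [set energy p.1 p.2 | p in [set p | G p.1 p.2]].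
have E_inf : has_inf E.
  split; first by exists (energy 0 0), (0, 0).
  by exists (- complex.Re c ^+ 2) => _ [[u a] /= Gua <-]; exact: energy_ge.
set m := inf E.
have m_le u a : G u a -> m <= energy u a.
  by move=> Gua; apply: ge_inf; [exact: E_inf.2 | exists (u, a)].
pose B d := [set u | exists2 a, G u a & energy u a < m + d].
have near_min d : 0 < d -> B d !=set0.
  move=> d0; have [_ [[u a] /= Gua <-] lt_d] := inf_adherent d0 E_inf.
  by exists u, a.
have G_mid u a v b : G u a -> G v b -> G (2^-1 *: (u + v)) (2^-1 * (a + b)).
  move=> Gu Gv.
  have := G_linear (2^-1) (G_linear 1 Gu Gv) G0.
  by rewrite !addr0 scale1r mul1r.
have B_diam d u v : B d u -> B d v -> complex.Re `|u - v| ^+ 2 < 4 * d.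
  move=> [a Gu u_lt] [b Gv v_lt].
  have := m_le _ _ (G_mid _ _ _ _ Gu Gv).
  rewrite (energy_midpoint _ a _ b); lra.
pose F := filter_from [set d : R | 0 < d] B.
have FF : ProperFilter F.
  apply: filter_from_proper => //.
  apply: filter_from_filter; first by exists 1 => /=.
  move=> d d' /= d0 d0'; exists (Num.min d d') => /=.
    by rewrite lt_min d0.
  move=> u [a Gu lt_u]; split; exists a => //; apply: lt_le_trans lt_u _.
    by rewrite lerD2l ge_min lexx.
  by rewrite lerD2l ge_min lexx orbT.
have F_cvg : cvg F.
  apply/cauchy_cvgP/cauchy_exP => eps eps0.
  pose r := complex.Re eps.
  have epsE : eps = r%:C%C by apply: ge0_Re; exact: ltW.
  have r0 : 0 < r by move: eps0; rewrite epsE ltcR.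
  have r40 : 0 < r ^+ 2 / 4 by rewrite divr_gt0 ?exprn_gt0.
  have [u Bu] := near_min _ r40.
  exists u, (r ^+ 2 / 4) => //= v Bv.
  rewrite -ball_normE /= epsE (ge0_Re (normr_ge0 _)) ltcR.
  rewrite -(@ltr_pXn2r _ 2) // ?nnegrE ?Re_norm_ge0 ?(ltW r0) //.
  by rewrite (lt_le_trans (B_diam _ _ _ Bu Bv)) // mulrC divfK.
set h := lim F.
have near_h d : 0 < d -> exists2 u, B d u & complex.Re `|u - h| < d.
  move=> d0.
  have F1 : F (B d) by exists d.
  have dC : 0 < d%:C%C by rewrite ltcR.
  have F2 : F (ball h d%:C%C) by apply: F_cvg; exact: nbhsx_ballx.
  have [u [Bu hu]] := filter_ex (filterI F1 F2).
  exists u => //; move: hu.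
  by rewrite -ball_normE /= distrC (ge0_Re (normr_ge0 _)) ltcR.
have dot_h u a : G u a -> a = dot u h.
  move=> Gua; apply/eqP; rewrite -subr_eq0 -normr_eq0; apply/eqP.
  set N := complex.Re `|u|.
  have bound d v b : G v b -> energy v b < m + d ->
      complex.Re `|a - dot u v| ^+ 2 <= d * (N ^+ 2 + 1).
    move=> Gvb lt_d.
    (* The variation at [v] along [s (a - <u, v>)^* u] lowers the energy by at
       least [s |a - <u, v>|^2] for this [s], but at most by [d]. *)
    pose s := (N ^+ 2 + 1)^-1.
    have N1 : 0 < N ^+ 2 + 1 by rewrite ltr_wpDl ?sqr_ge0.
    have := m_le _ _ (G_linear (s%:C%C * (a - dot u v)^*) Gua Gvb).
    rewrite (addrC (_ * a)) (addrC (_ *: u)) energy_var -ger0_ReX.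
    set e := a - dot u v; rewrite normrM norm_conjC exprMn.
    rewrite -[_ * e]mulrA -normCKC.
    rewrite (ger0_norm (_ : 0 <= s%:C%C)) ?lecR ?invr_ge0 ?(ltW N1) //.
    rewrite -rmorphXn (ReM_real (s ^+ 2)) (ReM_real s) !ger0_ReX -/N.
    move: lt_d; set D := complex.Re `|e|; move=> lt_d min_le.
    have sN : s * N ^+ 2 = 1 - s.
      by rewrite -[1](mulVf (lt0r_neq0 N1)) -/s; ring.
    have sD : 0 <= s ^+ 2 * D ^+ 2 by rewrite mulr_ge0 ?sqr_ge0.
    have : s * D ^+ 2 <= d.
      have : s ^+ 2 * D ^+ 2 * N ^+ 2 = s * D ^+ 2 - s ^+ 2 * D ^+ 2.
        transitivity (s * N ^+ 2 * (s * D ^+ 2)); first by ring.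
        by rewrite sN; ring.
      by lra.
    by rewrite /s ler_pdivrMl // mulrC.
  set D := complex.Re `|a - dot u h|.
  have D_le d : 0 < d -> d <= 1 -> D ^+ 2 <= d * (4 * N ^+ 2 + 2).
    move=> d0 d1; have [v [b Gvb lt_d] hv] := near_h _ d0.
    have D0_le := bound _ _ _ Gvb lt_d; set D0 := complex.Re _ in D0_le.
    have : D <= D0 + N * complex.Re `|v - h|.
      rewrite -lecR rmorphD rmorphM /= -!ge0_Re //.
      rewrite (_ : a - dot u h = (a - dot u v) + dot u (v - h)); last first.
        by rewrite dotBr; ring.
      by rewrite (le_trans (ler_normD _ _)) // lerD2l cauchy_schwarz.
    have := Re_norm_ge0 (v - h); have := Re_norm_ge0 u; rewrite -/N.
    set n := complex.Re `|v - h| in hv *.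
    have : 0 <= D0 by exact: Re_norm_ge0.
    have : 0 <= D by exact: Re_norm_ge0.
    move=> D_ge0 D0_ge0 N_ge0 n_ge0 D_le.
    have n2 : n ^+ 2 <= d by nra.
    have : D ^+ 2 <= (D0 + N * n) ^+ 2.
      by rewrite ler_pXn2r ?nnegrE ?(le_trans D_ge0).
    have : N ^+ 2 * n ^+ 2 <= N ^+ 2 * d by rewrite ler_wpM2l ?sqr_ge0.
    have := sqr_ge0 (D0 - N * n).
    nra.
  suff D0 : D = 0 by rewrite [LHS]ge0_Re // -/D D0.
  apply/eqP; rewrite -sqrf_eq0 eq_le sqr_ge0 andbT leNgt; apply/negP => D2.
  have N0 : 0 < 4 * N ^+ 2 + 2 by rewrite ltr_wpDl // mulr_ge0 // sqr_ge0.
  have DN : 0 < D ^+ 2 + (4 * N ^+ 2 + 2) by rewrite addr_gt0.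
  (* This choice of [d] is at most 1 and makes the bound smaller than [D^2]. *)
  have := D_le (D ^+ 2 / (D ^+ 2 + (4 * N ^+ 2 + 2))).
  rewrite divr_gt0 // ler_pdivrMr // mul1r lerDl (ltW N0) => /(_ isT isT).
  rewrite mulrAC ler_pdivlMr // ler_pM2l // gerDr leNgt.
  by rewrite D2.
have h_closure : closure [set u | exists a, G u a] h.
  move=> V /F_cvg FV.
  have F1 : F (B 1) by exists 1 => /=.
  have [u [[a Gu _] Vu]] := filter_ex (filterI F1 FV).
  by exists u; split => //; exists a.
exists h; split => //.
have [->|h0] := eqVneq h 0; first by rewrite normr0.
have h_gt0 : 0 < `|h| by rewrite normr_gt0.
rewrite -(ler_pM2r h_gt0) -expr2.
have -> : `|h| ^+ 2 = `|dot h h| by rewrite dot_norm ger0_norm ?exprn_ge0.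
pose f := (fun v => `|dot v h|) : H -> R[i]^o.
pose g := (fun v => c * `|v|) : H -> R[i]^o.
have cf : continuous f by move=> v; apply: cvg_norm; exact: dotl_continuous.
have cg : continuous g by move=> v; apply: cvgMr; exact: norm_continuous.
have /closure_id cl := closed_le_continuous cf cg.
suff : closure [set u | exists a, G u a] `<=` [set x | f x <= g x] by apply.
rewrite cl; apply: closureS => v [a Gv] /=.
by rewrite /f /g -(dot_h _ _ Gv) G_bounded.
Qed.

End riesz.

(** * Strong limits and adjoints *)

Section strong_limits.
Variables (C : numClosedFieldType) (H : normedModType C).

(** The usual density argument, in the form
[f - P f = (g - P g) + ((f - g) - P (f - g))] with [g] in the dense set; the
second term is at most [|f - g|]. *)
Lemma strong_cvg_dense (I : Type) (F : set_system I) (FF : Filter F)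
    (P : I -> H -> H) (D : set H) :
  closure D = [set: H] ->
  (forall i f g, P i (f - g) = P i f - P i g) ->
  (forall i f, `|f - P i f| <= `|f|) ->
  (forall f, D f -> P i f @[i --> F] --> f) ->
  forall f, P i f @[i --> F] --> f.
Proof.
move=> dD PB P_le PD f; apply/cvgrPdist_lt => d d0.
have d2 : 0 < d / 2 by rewrite divr_gt0.
have [g [Dg fg]] : D `&` ball f (d / 2) !=set0.
  have : closure D f by rewrite dD.
  by apply; exact: nbhsx_ballx.
have /cvgrPdist_lt/(_ _ d2) gP := PD g Dg.
apply: filterS gP => i gi.
have -> : f - P i f = (g - P i g) + ((f - g) - P i (f - g)).
  by rewrite PB addrACA -opprD (addrC g) subrK [P i g + _]addrC subrK.
rewrite (le_lt_trans (ler_normD _ _)) // (splitr d) ltrD //.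
rewrite (le_lt_trans (P_le _ _)) //.
by move: fg; rewrite -ball_normE.
Qed.

Variable dot : {dot H for Num.conj}.
Hypothesis dot_norm : forall f, dot f f = `|f| ^+ 2.

Lemma dot_inj u v : (forall w, dot w u = dot w v) -> u = v.
Proof.
move=> uv; apply/eqP; rewrite -subr_eq0 -normr_eq0 -sqrf_eq0 -dot_norm.
by rewrite dotBr uv subrr.
Qed.

(** Put [P = sum_j S_j T_j] and [a = sum_j |T_j f|^2 = <P f, f>].  Expanding
[sum_j |T_j (f - P f)|^2 >= 0], whose cross terms are both [|P f|^2], and using
[sum_j |T_j P f|^2 <= |P f|^2] gives [|P f|^2 <= a]; hence
[|f - P f|^2 = |f|^2 - 2 a + |P f|^2 <= |f|^2 - a]. *)
Lemma defect_le (J : choiceType) (S T : J -> H -> H) (A : {fset J}) :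
  (forall j f g, T j (f - g) = T j f - T j g) ->
  (forall j f g, dot (S j f) g = dot f (T j g)) ->
  (forall f, partial_sum (fun j => `|T j f| ^+ 2) A <= `|f| ^+ 2) ->
  forall f, `|f - partial_sum (fun j => S j (T j f)) A| ^+ 2 <=
    `|f| ^+ 2 - partial_sum (fun j => `|T j f| ^+ 2) A.
Proof.
move=> TB ST bessel f; set Pf := partial_sum _ A; set a := partial_sum _ A.
have dotPf g : dot Pf g = partial_sum (fun j => dot (T j f) (T j g)) A.
  by rewrite dot_suml; apply: eq_bigr => j _; rewrite ST.
have a_real : a^* = a.
  by apply/geC0_conj/sumr_ge0 => j _; rewrite exprn_ge0.
have Pff : dot Pf f = a.
  by rewrite dotPf; apply: eq_bigr => j _; rewrite dot_norm.
have fPf : dot f Pf = a by rewrite dotC Pff.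
have P2 : `|Pf| ^+ 2 <= a.
  have : 0 <= partial_sum (fun j => `|T j (f - Pf)| ^+ 2) A.
    by apply/sumr_ge0 => j _; rewrite exprn_ge0.
  rewrite (_ : partial_sum _ _ = a + partial_sum (fun j => `|T j Pf| ^+ 2) A -
     (`|Pf| ^+ 2 *+ 2)).
    rewrite subr_ge0 => le1; have := le_trans le1 (lerD (lexx a) (bessel Pf)).
    by rewrite mulr2n lerD2r.
  have E1 := dotPf Pf.
  have E2 : dot Pf Pf = partial_sum (fun j => dot (T j Pf) (T j f)) A.
    rewrite -[LHS]conjCK -dotC E1 rmorph_sum; apply: eq_bigr => j _ /=.
    by rewrite -dotC.
  rewrite mulr2n -!dot_norm {1}E1 E2 /a /partial_sum -!big_split -sumrB.
  by apply: eq_bigr => j _; rewrite TB (normB_sqr dot_norm).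
rewrite (normB_sqr dot_norm) fPf Pff -subr_ge0.
rewrite (_ : _ - _ = a - `|Pf| ^+ 2) ?subr_ge0 //.
ring.
Qed.

End strong_limits.

Section adjoints.
Variables (R : realType) (H : completeNormedModType R[i]).
Variable dot : {dot H for Num.conj}.
Hypothesis dot_norm : forall f, dot f f = `|f| ^+ 2.

Lemma adjoint_exists (S : {linear H -> H}) (c : R[i]) : 0 <= c ->
  (forall f, `|S f| <= c * `|f|) ->
  exists2 T : {linear H -> H}, forall f g, dot (S f) g = dot f (T g)
    & forall g, `|T g| <= c * `|g|.
Proof.
move=> c0 S_le.
have /choice[T TE] g : exists h,
    (forall f, dot (S f) g = dot f h) /\ `|h| <= c * `|g|.
  have [||||h [hE _ h_le]] := @riesz_relation _ _ dot dot_norm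
    (fun f a => a = dot (S f) g) _ _ (c * `|g|).
  - by move=> t u a v b -> ->; rewrite linearP dotDl dotZl.
  - by rewrite linear0 linear0l.
  - by rewrite mulr_ge0.
  - move=> u a ->; rewrite mulrAC.
    by rewrite (le_trans (cauchy_schwarz dot_norm _ _)) // ler_wpM2r.
  - by exists h; split=> // f; exact: hE.
have T_linear : linear T.
  move=> t u v; apply: (dot_inj dot_norm) => w.
  by rewrite -(TE _).1 dotDr dotZr !dotDr dotZr !(TE _).1.
exists (HB.pack_for {linear H -> H} T
  (GRing.isLinear.Build _ _ _ _ T T_linear)).
  by move=> f g; exact: (TE g).1.
by move=> g; exact: (TE g).2.
Qed.

End adjoints.

(** * Combinations of kernel functions *)

Section rkhs_theory.
Variables (R : realType) (U : Type) (k : U -> U -> R[i]) (H : rkhs k).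

Lemma dot_kfunl f w : dot H (kfun H w) f = (ev H f w)^*.
Proof. by rewrite dotC reproducing. Qed.

(** Combinations are kept as lists of coefficients and points: rules such as
[pull] below are defined on these expressions, before one knows that they
respect equality of the resulting vectors. *)
Definition comb (s : seq (R[i] * U)) : H := \sum_(p <- s) p.1 *: kfun H p.2.

Definition scale_comb (t : R[i]) (s : seq (R[i] * U)) :=
  [seq (t * p.1, p.2) | p <- s].

Lemma comb_linear t s s' : comb (scale_comb t s ++ s') = t *: comb s + comb s'.
Proof.
rewrite /comb big_cat big_map scaler_sumr; congr (_ + _).
by apply: eq_bigr => p _; rewrite scalerA.
Qed.

Lemma dot_comb s f : dot H (comb s) f = \sum_(p <- s) p.1 * (ev H f p.2)^*.
Proof.
by rewrite dot_suml; apply: eq_bigr => p _; rewrite dotZl dot_kfunl.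
Qed.

(** If [g] is in the space, then [sum_p c_p g(w_p)^*] is the inner product of
[sum_p c_p K_(w_p)] with [g]; conversely, a bound on these numbers lets the
Riesz theorem produce [g]. *)
Lemma rkhs_membership (g : U -> R[i]) (c : R[i]) : 0 <= c ->
  (forall s, `|\sum_(p <- s) p.1 * (g p.2)^*| <= c * `|comb s|) ->
  exists2 h : H, ev H h = g & `|h| <= c.
Proof.
move=> c0 g_le.
have [||||h [hE _ h_le]] := @riesz_relation _ _ (dot H) (@dot_norm _ _ _ H)
  (fun f a => exists2 s, f = comb s & a = \sum_(p <- s) p.1 * (g p.2)^*) _ _ c.
- move=> t u a v b [s -> ->] [s' -> ->]; exists (scale_comb t s ++ s').
    by rewrite comb_linear.
  rewrite big_cat big_map mulr_sumr; congr (_ + _).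
  by apply: eq_bigr => p _; rewrite mulrA.
- by exists [::]; rewrite /comb !big_nil.
- exact: c0.
- by move=> u a [s -> ->].
- exists h => //; apply/funext => w.
  have := hE (kfun H w) ((g w)^*).
  rewrite dot_kfunl => gh; apply: (can_inj (@conjCK _)); rewrite gh //.
  by exists [:: (1, w)]; rewrite /comb big_seq1 ?scale1r ?mul1r.
Qed.

(** The vector representing [<., f>] on combinations lies in their closure, and
has the same values as [f] at all points, so it is [f]. *)
Lemma comb_dense : closure [set comb s | s in [set: seq (R[i] * U)]] = [set: H].
Proof.
apply/seteqP; split => // f _.
have [||||h [hE + _]] := @riesz_relation _ _ (dot H) (@dot_norm _ _ _ H)
  (fun u a => (exists s, u = comb s) /\ a = dot H u f) _ _ `|f|.
- move=> t u a v b [[s ->] ->] [[s' ->] ->]; split; last by rewrite dotDl dotZl.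
  by exists (scale_comb t s ++ s'); rewrite comb_linear.
- by split; [exists [::]; rewrite /comb big_nil | rewrite linear0l].
- exact: normr_ge0.
- move=> u a [_ ->]; rewrite mulrC.
  by apply: cauchy_schwarz; exact: dot_norm.
have -> : h = f.
  apply: (@ev_inj _ _ _ H); apply/funext => w.
  apply: (can_inj (@conjCK _)); rewrite -!dot_kfunl; apply/esym/hE; split => //.
  by exists [:: (1, w)]; rewrite /comb big_seq1 scale1r.
by apply: closureS => u [a [[s ->] _]]; exists s.
Qed.

End rkhs_theory.

(** * Expansion of a kernel along an orthonormal basis *)

Section orthonormal_bases.
Variables (R : realType) (U : Type) (k : U -> U -> R[i]) (H : rkhs k).
Variables (J : choiceType) (e : J -> H).

Definition fourier (A : {fset J}) (f : H) : H :=
  partial_sum (fun j => dot H f (e j) *: e j) A.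

Lemma fourierB A f g : fourier A (f - g) = fourier A f - fourier A g.
Proof.
rewrite /fourier /partial_sum -sumrB; apply: eq_bigr => j _.
by rewrite dotBl scalerBl.
Qed.

Lemma fourierZ A c f : fourier A (c *: f) = c *: fourier A f.
Proof.
rewrite /fourier /partial_sum scaler_sumr; apply: eq_bigr => j _.
by rewrite dotZl scalerA.
Qed.

Lemma fourier_sum A I (r : seq I) (f : I -> H) :
  fourier A (\sum_(i <- r) f i) = \sum_(i <- r) fourier A (f i).
Proof.
rewrite /fourier /partial_sum exchange_big; apply: eq_bigr => j _ /=.
by rewrite dot_suml scaler_suml.
Qed.

Hypothesis e_onb : orthonormal_basis e.

Lemma fourier_basis (A : {fset J}) (i : A) : fourier A (e (val i)) = e (val i).
Proof.
rewrite /fourier /partial_sum (bigD1 i) //= e_onb.1 eqxx scale1r.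
rewrite big1 ?addr0 // => j ji.
by rewrite e_onb.1 val_eqE eq_sym (negPf ji) scale0r.
Qed.

(** Pythagoras: [|f - fourier A f|^2 = |f|^2 - sum_(j in A) |<f, e_j>|^2]. *)
Lemma fourier_defect A f : `|f - fourier A f| <= `|f|.
Proof.
rewrite -(@ler_pXn2r _ 2) ?nnegrE // (normB_sqr (@dot_norm _ _ _ H)).
set a := \sum_(i : A) `|dot H f (e (val i))| ^+ 2.
have a0 : 0 <= a by apply: sumr_ge0 => i _; rewrite exprn_ge0.
have dotf : dot H (fourier A f) f = a.
  rewrite dot_suml; apply: eq_bigr => i _.
  by rewrite dotZl (dotC _ (e _)) normCK.
have -> : dot H f (fourier A f) = a by rewrite dotC dotf geC0_conj.
rewrite dotf.
have -> : `|fourier A f| ^+ 2 = a.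
  rewrite -(@dot_norm _ _ _ H) {2}/fourier dot_sumr; apply: eq_bigr => i _.
  rewrite dotZr dot_suml mulrC normCK; congr (_ * _).
  rewrite (bigD1 i) //= dotZl e_onb.1 eqxx mulr1 big1 ?addr0 // => j ji.
  by rewrite dotZl e_onb.1 val_eqE (negPf ji) mulr0.
by rewrite opprD addrA addrK gerDl oppr_le0.
Qed.

Lemma fourier_cvg f : fourier A f @[A --> totally] --> f.
Proof.
apply: (strong_cvg_dense _ (e_onb.2)) f => [A f g|A f|_ [A [c ->]]].
- exact: fourierB.
- exact: fourier_defect.
apply: cvg_near_cst; exists A => // B /= AB.
rewrite {2}/partial_sum fourier_sum; apply: eq_bigr => i _.
have iB : val i \in B by apply: (fsubsetP AB); exact: valP.
by rewrite fourierZ (fourier_basis [` iB]%fset).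
Qed.

(** Take the inner product with [k_z] in the Fourier expansion of [k_w], whose
coefficients are [<k_w, e_j> = e_j(w)^*]. *)
Lemma kernel_expansion z w :
  (partial_sum (fun j => ev H (e j) z * (ev H (e j) w)^*) A : R[i]^o)
    @[A --> totally] --> (k z w : R[i]^o).
Proof.
have lim := @fourier_cvg (kfun H w).
have cont := @dotl_continuous _ _ (dot H) (@dot_norm _ _ _ H)
  (kfun H z) (kfun H w).
have := cvg_comp _ _ lim cont.
rewrite reproducing kfunE; apply: cvg_trans; apply: near_eq_cvg; near=> A.
rewrite /= dot_suml; apply: eq_bigr => j _.
by rewrite dotZl reproducing dot_kfunl mulrC.
Unshelve. all: by end_near. Qed.

End orthonormal_bases.

(** * The operators attached to a factorized kernel *)

Section kernel_norms.
Variables (R : realType) (U : Type) (K : U -> U -> R[i]) (H : rkhs K).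

Lemma comb_norm_sqr (s : seq (R[i] * U)) :
  `|comb H s| ^+ 2 = \sum_(p <- s) \sum_(q <- s) p.1 * q.1^* * K q.2 p.2.
Proof.
rewrite -(@dot_norm _ _ _ H) dot_suml; apply: eq_bigr => p _.
rewrite dot_sumr; apply: eq_bigr => q _.
by rewrite dotZl dotZr mulrA reproducing kfunE.
Qed.

End kernel_norms.

Section factorized_kernel.
Variables (R : realType) (U : Type) (rho : U -> U).
Variables (k : U -> U -> R[i]) (Hk : rkhs k).
Variables (J : choiceType) (e : J -> Hk).
Hypothesis e_onb : orthonormal_basis e.
Variables (K : U -> U -> R[i]) (HK : rkhs K).
Hypothesis K_eq : forall z w, K z w = k z w * K (rho z) (rho w).

(** The adjoint of [f |-> e_j (f o rho)], at the level of expressions. *)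
Definition pull (j : J) (s : seq (R[i] * U)) : seq (R[i] * U) :=
  [seq (p.1 * (ev Hk (e j) p.2)^*, rho p.2) | p <- s].

(** The functional equation enters here: the limit of the Gram coefficients
[K(rho w_q, rho w_p) sum_(j in A) e_j(w_q) e_j(w_p)^*] is
[K(rho w_q, rho w_p) k(w_q, w_p) = K(w_q, w_p)]. *)
Lemma pull_norm_cvg s :
  (partial_sum (fun j => `|comb HK (pull j s)| ^+ 2) A : R[i]^o)
    @[A --> totally] --> (`|comb HK s| ^+ 2 : R[i]^o).
Proof.
pose G p q := p.1 * q.1^* * K (rho q.2) (rho p.2).
have -> : (fun A =>
    partial_sum (fun j => `|comb HK (pull j s)| ^+ 2) A : R[i]^o) =
  fun A => \sum_(p <- s) \sum_(q <- s)
     (G p q * partial_sum (fun j => ev Hk (e j) q.2 * (ev Hk (e j) p.2)^*) A).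
  apply/funext => A; rewrite /partial_sum.
  under eq_bigr do rewrite comb_norm_sqr big_map.
  rewrite exchange_big; apply: eq_bigr => p _.
  under eq_bigr do rewrite big_map.
  rewrite exchange_big; apply: eq_bigr => q _.
  rewrite mulr_sumr; apply: eq_bigr => j _ /=.
  by rewrite /G rmorphM /= conjCK; ring.
rewrite comb_norm_sqr.
apply: cvg_big => [|p _]; first exact: add_continuous.
apply: cvg_big => [|q _]; first exact: add_continuous.
rewrite K_eq (_ : _ * _ = G p q * k q.2 p.2); last by rewrite /G; ring.
by apply: cvgMr; exact: kernel_expansion.
Qed.

Lemma pull_norm_sum_le s A :
  partial_sum (fun j => `|comb HK (pull j s)| ^+ 2) A <= `|comb HK s| ^+ 2.
Proof.
apply: (partial_sum_le_cvg _ (@pull_norm_cvg s)) => j.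
exact: exprn_ge0.
Qed.

Lemma pull_norm_le j s : `|comb HK (pull j s)| <= `|comb HK s|.
Proof.
rewrite -(@ler_pXn2r _ 2) ?nnegrE //.
have := pull_norm_sum_le s [fset j]%fset.
rewrite /partial_sum (bigD1 [` fset11 j]%fset) //= big1 ?addr0 // => i.
by rewrite -val_eqE /=; have := valP i; rewrite inE => ->.
Qed.

(** The functional attached to [e_j (f o rho)] by the membership criterion is
[s |-> <pull j s, f>], and [pull j] does not increase norms. *)
Lemma mult_comp_exists j f : exists2 h : HK,
  ev HK h = (fun z => ev Hk (e j) z * ev HK f (rho z)) & `|h| <= `|f|.
Proof.
apply: rkhs_membership => // s.
rewrite (_ : \sum_(p <- s) _ = dot HK (comb HK (pull j s)) f).
  rewrite (le_trans (cauchy_schwarz (@dot_norm _ _ _ HK) _ _)) // mulrC.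
  rewrite ler_wpM2l //.
  exact: pull_norm_le.
by rewrite dot_comb big_map; apply: eq_bigr => p _ /=; rewrite rmorphM mulrA.
Qed.

Lemma mult_comp_operator j : exists2 S : {linear HK -> HK},
    forall f z, ev HK (S f) z = ev Hk (e j) z * ev HK f (rho z)
  & forall f, `|S f| <= `|f|.
Proof.
have /choice[S SP] f : exists h : HK,
    ev HK h = (fun z => ev Hk (e j) z * ev HK f (rho z)) /\ `|h| <= `|f|.
  by have [h ? ?] := mult_comp_exists j f; exists h.
have S_linear : linear S.
  move=> t f g; apply: (@ev_inj _ _ _ HK); rewrite linearP !(SP _).1 linearP.
  by apply/funext => z; rewrite !fctE /= mulrDr mulrCA.
exists (HB.pack_for {linear HK -> HK} S
  (GRing.isLinear.Build _ _ _ _ S S_linear)).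
  by move=> f z; have [-> _] := SP f.
by move=> f; have [] := SP f.
Qed.

End factorized_kernel.

Theorem theorem3p2 (R : realType) (U : topologicalType) (rho : U -> U)
    (k : U -> U -> R[i]) (k_pd : positive_definite k) (Hk : rkhs k)
    (J : choiceType) (e : J -> Hk) (e_onb : orthonormal_basis e)
    (K : U -> U -> R[i]) (K_pd : positive_definite K)
    (K_eq : forall z w, K z w = k z w * K (rho z) (rho w))
    (HK : rkhs K) :
  exists S : J -> {linear HK -> HK},
    [/\ forall j f z, ev HK (S j f) z = ev Hk (e j) z * ev HK f (rho z),
        forall j, continuous (S j)
      & exists Sadj : J -> {linear HK -> HK},
          (forall j, is_adjoint (S j) (Sadj j)) /\
          strong_sum (fun j => S j \o Sadj j) idfun].
Proof.
have normK : forall f, dot HK f f = `|f| ^+ 2 := @dot_norm _ _ _ HK.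
have /choice[S S_spec] j : exists S : {linear HK -> HK},
    (forall f z, ev HK (S f) z = ev Hk (e j) z * ev HK f (rho z)) /\
    (forall f, `|S f| <= `|f|).
  by have [S ? ?] := mult_comp_operator e_onb HK K_eq j; exists S.
have S_ev j := (S_spec j).1; have S_le j := (S_spec j).2.
have /choice[T T_spec] j : exists T : {linear HK -> HK},
    is_adjoint (S j) T /\ (forall g, `|T g| <= `|g|).
  have [|T ST T_le] := adjoint_exists normK (S := S j) ler01.
    by move=> f; rewrite mul1r.
  by exists T; split => // g; rewrite -[leRHS]mul1r.
have ST j : is_adjoint (S j) (T j) := (T_spec j).1.
have T_cont j : continuous (T j).
  by apply: contraction_continuous; exact: (T_spec j).2.
exists S; split => // [j|]; first exact: contraction_continuous.
exists T; split => // f.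
have T_comb j s : T j (comb HK s) = comb HK (pull rho e j s).
  apply: (dot_inj normK) => g; rewrite -ST; apply: (can_inj (@conjCK _)).
  rewrite -!dotC !dot_comb big_map; apply: eq_bigr => p _ /=.
  by rewrite S_ev rmorphM mulrA.
have T_sum A s : partial_sum (fun j => `|T j (comb HK s)| ^+ 2) A =
    partial_sum (fun j => `|comb HK (pull rho e j s)| ^+ 2) A.
  by apply: eq_bigr => j _; rewrite T_comb.
(* Both sides are continuous in [g], and combinations of kernel functions are
   dense. *)
have bessel A g : partial_sum (fun j => `|T j g| ^+ 2) A <= `|g| ^+ 2.
  pose E (h : HK) : R[i]^o := partial_sum (fun j => `|T j h| ^+ 2) A.
  pose N (h : HK) : R[i]^o := `|h| ^+ 2.
  have sqr_cont (h : HK -> HK) : continuous h ->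
      continuous (fun x => `|h x| ^+ 2 : R[i]^o).
    by move=> ch x; apply: cvgM; apply: cvg_norm; exact: ch.
  apply: (@dense_le _ _ _ E N (comb_dense HK)) g.
  - move=> x; apply: cvg_big; first exact: add_continuous.
    by move=> j _; apply: sqr_cont; exact: T_cont.
  - by apply: (sqr_cont id) => x; exact: cvg_id.
  - by move=> _ [s _ <-]; rewrite /E T_sum; exact: pull_norm_sum_le.
have defect A g :=
  defect_le normK (A := A) (fun j f g => linearB (T j) f g) ST (bessel A) g.
pose P A g := partial_sum (fun j => S j (T j g)) A.
apply: (strong_cvg_dense (P := P) _ (comb_dense HK)) f
  => [A f g|A g|_ [s _ <-]].
- rewrite /P /partial_sum -sumrB; apply: eq_bigr => j _.
  by rewrite !linearB.
- rewrite -(@ler_pXn2r _ 2) ?nnegrE //; apply: le_trans (defect A g) _.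
  by rewrite gerDl oppr_le0; apply: sumr_ge0 => j _; rewrite exprn_ge0.
apply/cvgrPdist_lt => d d0.
have /cvgrPdist_lt/(_ _ (exprn_gt0 2 d0)) :=
  @pull_norm_cvg _ _ _ _ _ _ _ e_onb _ HK K_eq s.
apply: filterS => A A_lt.
rewrite -(@ltr_pXn2r _ 2) ?nnegrE ?(ltW d0) //.
apply: le_lt_trans (defect A _) _; apply: le_lt_trans A_lt.
rewrite T_sum; apply: real_ler_norm.
by rewrite ger0_real // subr_ge0; exact: pull_norm_sum_le.
Qed.
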